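(* Let $M$ be a compact, connected, smooth Riemannian manifold without boundary, and let $X_1, X_2, \dots$ be $M$-valued random variables, each with the same distribution $\mu \in \mathcal{P}(M)$. Let $\mu_N = N^{-1}\sum_{n=1}^N \delta_{X_n}$. If $N^{-2}\sum_{1 \le m<n \le N} \alpha(X_m,X_n) \to 0$ as $N \to \infty$, then $\mathbb{E}\, W_2^2(\mu_N,\mu) \to 0$ as $N \to \infty$.
   Context: $\mathcal{P}(M)$ denotes the set of Borel probability measures on $M$, and $\rho$ the geodesic distance on $M$. The quadratic Wasserstein metric is $W_2(\mu,\nu)=\inf_{\pi}\left(\int_{M\times M}\rho(x,y)^2\,\mathrm{d}\pi(x,y)\right)^{1/2}$, the infimum over all couplings $\pi\in\mathcal{P}(M\times M)$ of $\mu$ and $\nu$ (i.e. with marginals $\mu$ and $\nu$). The $\alpha$-mixing coefficient of two $M$-valued random variables $X,Y$ is $\alpha(X,Y)=\sup_{A,B}|\Pr(X\in A, Y\in B)-\Pr(X\in A)\Pr(Y\in B)|$, the supremum over Borel sets $A,B\subseteq M$. *)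

(* Defs.v *)
From HB Require Import structures.
From mathcomp Require Import all_boot all_order all_algebra.
From mathcomp Require Import all_classical all_reals all_analysis.
Set Implicit Arguments.
Unset Strict Implicit.
Unset Printing Implicit Defensive.
Import Order.TTheory GRing.Theory Num.Theory.
Local Open Scope classical_set_scope.
Local Open Scope ring_scope.

Section Defs.
Context {R : realType}.

Section metric.
Context {M : Type} (rho : M -> M -> R).

Definition is_metric : Prop :=
  [/\ forall x y, 0 <= rho x y,
      forall x y, rho x y = 0 <-> x = y,
      forall x y, rho x y = rho y x &
      forall x y z, rho x z <= rho x y + rho y z].

Definition rho_ball (x : M) (e : R) : set M := [set y | rho x y < e].

Definition rho_open (U : set M) : Prop :=
  forall x, U x -> exists2 e : R, 0 < e & rho_ball x e `<=` U.

Definition rho_compact : Prop :=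
  forall (I : Type) (U : I -> set M), (forall i, rho_open (U i)) ->
    (forall x, exists i, U i x) ->
    exists (n : nat) (f : 'I_n -> I), forall x, exists k, U (f k) x.

Definition rho_connected : Prop :=
  forall A : set M, rho_open A -> rho_open (~` A) -> A = set0 \/ A = setT.

Definition rho_borel : set (set M) := <<s rho_open >>.
End metric.

Section wasserstein.
Context {d : measure_display} {M : measurableType d} (rho : M -> M -> R).

Definition is_coupling (nu1 nu2 : set M -> \bar R)
  (pi : probability (M * M)%type R) : Prop :=
  forall A : set M, measurable A ->
    pi (A `*` setT) = nu1 A /\ pi (setT `*` A) = nu2 A.

Definition wasserstein2_sq (nu1 nu2 : set M -> \bar R) : \bar R :=
  ereal_inf [set (\int[pi]_z ((rho z.1 z.2) ^+ 2)%:E)%E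
            | pi in [set pi | is_coupling nu1 nu2 pi]].
End wasserstein.

Section mixing.
Context {dO : measure_display} {Omega : measurableType dO}
        {d : measure_display} {M : measurableType d}
        (P : probability Omega R).

Definition alpha_mixing (X Y : Omega -> M) : R :=
  sup [set r : R | exists A B : set M, [/\ measurable A, measurable B &
         r = `| fine (P (X @^-1` A `&` Y @^-1` B))
                - fine (P (X @^-1` A)) * fine (P (Y @^-1` B)) |]].

Definition empirical_measure (X : nat -> Omega -> M) (N : nat) (w : Omega)
  : set M -> \bar R :=
  fun A => (((N%:R)^-1)%:E * \sum_(n < N) (\1_A (X n w))%:E)%E.
End mixing.
End Defs.

(* Main.v *)
Require Import Defs.
From HB Require Import structures.
From mathcomp Require Import all_boot all_order all_algebra.
From mathcomp Require Import all_classical all_reals all_analysis.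
From mathcomp Require Import measurable_realfun ring lra.
Set Implicit Arguments.
Unset Strict Implicit.
Import Order.TTheory GRing.Theory Num.Theory numFieldNormedType.Exports.
Local Open Scope classical_set_scope.
Local Open Scope ring_scope.

(** Cut M into finitely many Borel cells A_i of small diameter. Two
    probabilities nu1, nu2 can be coupled so that the mass outside the union
    of the A_i x A_i is at most sum_i |nu1(A_i) - nu2(A_i)|: on each
    A_j x A_i use a multiple of nu1 x nu2, the multiples coming from a transport
    plan between the two vectors of cell masses that leaves in place as much
    mass as possible. Hence W_2^2(nu1, nu2) is at most a small constant plus
    diam(M)^2 times that sum. For nu1 = mu_N and nu2 = mu the i-th term has
    second moment
    N^-2 sum_{m,n} (P(X_m in A_i, X_n in A_i) - mu(A_i)^2), which
    is at most N^-2 (N + 2 sum_{m<n} alpha(X_m, X_n)) and so tends to 0. *)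

(** * Preliminaries on integrals and finite sums of measures *)

(* The integral of a nonnegative function is a supremum over simple functions
   below it, so no measurability is needed: neither [rho] on the product
   sigma-algebra nor the map [w |-> W_2^2(mu_N(w), mu)] is known to be
   measurable here. *)
Lemma le_lower_integral (d : measure_display) (T : measurableType d)
  (R : realType) (mu : {measure set T -> \bar R}) (f g : T -> \bar R) :
  (forall x, 0 <= f x)%E -> (forall x, f x <= g x)%E ->
  (\int[mu]_x f x <= \int[mu]_x g x)%E.
Proof.
move=> f0 fg; have g0 x : (0 <= g x)%E by exact: le_trans (f0 x) (fg x).
rewrite !ge0_integralTE//; apply: ereal_sup_le => _ [h hf <-].
by exists h => // x; exact: le_trans (hf x) (fg x).
Qed.

(* [Q0] only serves as the default value of [mnormalize]. *)
Lemma probability_of_measure (d : measure_display) (T : measurableType d)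
  (R : realType) (Q0 : probability T R) (m : {measure set T -> \bar R}) :
  m setT = 1%E -> exists Q : probability T R, forall A, Q A = m A.
Proof.
move=> m1; exists (mnormalize m Q0) => A.
rewrite /= /mnormalize m1 onee_eq0 /= invr1. exact: mule1.
Qed.

(** Packages a finite sum of set functions as a genuine measure. It is used twice: for the weighted
    restrictions that build the coupling, and for the Dirac masses of the empirical measure. *)
Lemma measure_seq_sum (d : measure_display) (T : measurableType d)
  (R : realType) (I : Type) (s : seq I) (m : I -> {measure set T -> \bar R}) :
  exists mu : {measure set T -> \bar R},
    forall A, (mu A = \sum_(i <- s) m i A)%E.
Proof.
elim: s => [|i s [mu muE]].
  by exists mzero => A; rewrite big_nil.
exists (measure_add (m i) mu) => A.
by rewrite big_cons -muE; exact: measure_addE.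
Qed.

(** * Transport between two finite vectors of masses *)

(** Keep [m i], the minimum of [q i] and [p i], on the diagonal. The surpluses [q j - m j] and the
    deficits [p i - m i] have the same total [S], so the surplus is spread over the deficits in
    product form, divided by [S]. The mass off the diagonal is then at most [S]. *)
Lemma transport_plan (R : realType) (I : finType) (q p : I -> R) :
  (forall i, 0 <= q i) -> (forall i, 0 <= p i) ->
  \sum_i q i = 1 -> \sum_i p i = 1 ->
  exists t : I -> I -> R, [/\ forall j i, 0 <= t j i,
    forall j, \sum_i t j i = q j, forall i, \sum_j t j i = p i &
    1 - \sum_i t i i <= \sum_i `|q i - p i|].
Proof.
move=> q0 p0 q1 p1.
pose m i := Num.min (q i) (p i).
have mq i : m i <= q i by rewrite ge_min lexx.
have mp i : m i <= p i by rewrite ge_min lexx orbT.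
have m0 i : 0 <= m i by rewrite le_min q0 p0.
pose S := \sum_i (p i - m i).
have Sp : \sum_i (p i - m i) = S by [].
have Sq : \sum_i (q i - m i) = S by rewrite /S !big_split/= q1 p1.
have S0 : 0 <= S by apply: sumr_ge0 => i _; rewrite subr_ge0.
pose t j i := (if j == i then m i else 0) + (q j - m j) * (p i - m i) / S.
have tge j i : 0 <= (q j - m j) * (p i - m i) / S.
  by rewrite divr_ge0// mulr_ge0// subr_ge0.
(* Cancelling [S] is sound even when [S = 0], where the quotient is the default value 0: every
   surplus and deficit lies between 0 and [S], hence vanishes too. *)
have Sr (x : R) : 0 <= x -> x <= S -> x * S / S = x.
  move=> x0 xS; have [S0'|S0'] := eqVneq S 0; last by rewrite mulfK.
  by rewrite S0' mulr0 mul0r; apply/le_anti; rewrite x0 -S0' xS.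
have qS j : q j - m j <= S.
  rewrite -Sq (bigD1 j)//= lerDl; apply: sumr_ge0 => i _.
  by rewrite subr_ge0.
have pS j : p j - m j <= S.
  rewrite -Sp (bigD1 j)//= lerDl; apply: sumr_ge0 => i _.
  by rewrite subr_ge0.
exists t; split.
- move=> j i; rewrite addr_ge0//.
  by case: ifP.
- move=> j; rewrite big_split/= -big_mkcond/= (big_pred1 j); last first.
    by move=> i /=; rewrite eq_sym.
  by rewrite -mulr_suml -mulr_sumr Sp Sr ?subr_ge0// addrC subrK.
- move=> i; rewrite big_split/= -big_mkcond/= (big_pred1 i)//.
  rewrite -mulr_suml -mulr_suml Sq [S * _]mulrC Sr ?subr_ge0//.
  by rewrite addrC subrK.
- apply: (@le_trans _ _ S).
    rewrite /S sumrB p1 lerB//; apply: ler_sum => i _.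
    by rewrite /t eqxx lerDl.
  (* Termwise, [q i - m i] is the positive part of [q i - p i]. *)
  rewrite -Sq; apply: ler_sum => i _; rewrite /m.
  by case: (leP (q i) (p i)) => h; rewrite ?subrr ?normr_ge0 ?ler_norm.
Qed.

(* Terms with [p i = 0] or [q = 0] contribute the junk quotient [0]. *)
Lemma transport_weight (R : realType) (I : finType) (t p : I -> R) (q r : R) :
  (forall i, 0 <= t i) -> (forall i, t i <= p i) -> \sum_i t i = q ->
  0 <= r -> r <= q ->
  \sum_i t i / (q * p i) * (r * p i) = r.
Proof.
move=> t0 tp tq r0 rq.
have [q0|q0] := eqVneq q 0.
  have -> : r = 0 by apply/le_anti; rewrite r0 -q0 rq.
  by rewrite big1// => i _; rewrite mul0r mulr0.
rewrite (eq_bigr (fun i => t i * (r / q))).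
  by rewrite -mulr_suml tq mulrC mulfVK.
move=> i _; have [pi0|pi0] := eqVneq (p i) 0; last by field; rewrite q0 pi0.
have -> : t i = 0 by apply/le_anti; rewrite t0 -pi0 tp.
by rewrite !mul0r.
Qed.

(** * Coupling along a finite partition and the bound on the Wasserstein distance *)

Lemma bigcup_bigsetU (T : Type) (I : finType) (F : I -> set T) :
  \bigcup_i F i = \big[setU/set0]_i F i.
Proof.
rewrite -bigcup_seq; apply: eq_bigcupl.
by split=> // i _ /=; exact: mem_index_enum.
Qed.

Lemma measure_partition (d : measure_display) (T : measurableType d)
  (R : realType) (mu : {measure set T -> \bar R}) (k : nat)
  (A : 'I_k -> set T) (B : set T) : (forall i, measurable (A i)) ->
  trivIset setT A -> (forall x, exists i, A i x) -> measurable B ->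
  mu B = (\sum_i mu (B `&` A i))%E.
Proof.
move=> mA tA cA mB.
rewrite -measure_bigsetU_ord.
- rewrite -bigcup_bigsetU -setI_bigcupr; congr (mu _).
  by rewrite setIidl// => x _; have [i Aix] := cA x; exists i.
- by move=> i; exact: measurableI.
- exact: trivIset_setIl.
Qed.

(** On the rectangle A_j x A_i put nu1 x nu2 with density [t j i / (q j * p i)], which gives that
    rectangle mass [t j i]. Inside each cell the conditional laws are kept, so the marginals follow
    from the row and column sums of [t], and the diagonal cells carry at least the trace of [t]. *)
Lemma partition_coupling (d : measure_display) (M : measurableType d)
  (R : realType) (nu1 nu2 : probability M R) (k : nat) (A : 'I_k -> set M) :
  (forall i, measurable (A i)) -> trivIset setT A ->
  (forall x, exists i, A i x) ->
  exists2 pi : probability (M * M)%type R, is_coupling nu1 nu2 pi &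
    (pi (~` \bigcup_i (A i `*` A i)) <=
     (\sum_i `|fine (nu1 (A i)) - fine (nu2 (A i))|)%:E)%E.
Proof.
move=> mA tA cA.
have fin (nu : probability M R) B : measurable B -> (fine (nu B))%:E = nu B.
  by move=> mB; rewrite fineK// fin_num_measure.
have part (nu : probability M R) B : measurable B ->
    \sum_i fine (nu (B `&` A i)) = fine (nu B).
  move=> mB; apply: EFin_inj; rewrite fin// (measure_partition nu mA tA cA mB).
  rewrite -sumEFin; apply: eq_bigr => i _; rewrite fin//.
  exact: measurableI.
have partT (nu : probability M R) : \sum_i fine (nu (A i)) = 1.
  rewrite -[RHS]/(fine 1%E) -(probability_setT nu) -part//.
  by apply: eq_bigr => i _; rewrite setTI.
pose q i := fine (nu1 (A i)); pose p i := fine (nu2 (A i)).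
have ge0 (nu : probability M R) B : 0 <= fine (nu B) by exact: fine_ge0.
have le (nu : probability M R) B i : measurable B ->
    fine (nu (B `&` A i)) <= fine (nu (A i)).
  move=> mB; have mBA : measurable (B `&` A i) by exact: measurableI.
  by rewrite -lee_fin !fin// le_measure ?inE.
have [t [t0 tq tp tdiag]] := @transport_plan R 'I_k q p
  (fun i => ge0 nu1 _) (fun i => ge0 nu2 _) (partT nu1) (partT nu2).
have tleq j i : t j i <= q j.
  by rewrite -(tq j) (bigD1 i)//= lerDl sumr_ge0.
have tlep j i : t j i <= p i.
  by rewrite -(tp i) (bigD1 j)//= lerDl sumr_ge0.
have c0 j i : 0 <= t j i / (q j * p i).
  by rewrite divr_ge0// mulr_ge0// ge0.
have mAA j i : measurable (A j `*` A i) by exact: measurableX.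
have [pi0 pi0E] := @measure_seq_sum _ _ R _ (index_enum ('I_k * 'I_k)%type)
  (fun u => mscale (NngNum (c0 u.1 u.2))
              (mrestr (nu1 \x nu2)%E (mAA u.1 u.2))).
have rect B1 B2 : measurable B1 -> measurable B2 -> pi0 (B1 `*` B2) =
    (\sum_j \sum_i t j i / (q j * p i) *
      (fine (nu1 (B1 `&` A j)) * fine (nu2 (B2 `&` A i))))%:E.
  move=> mB1 mB2; rewrite pi0E pair_big/= -sumEFin.
  apply: eq_bigr => -[j i] _ /=.
  rewrite /mscale/= /mrestr -setXI product_measure1E; try exact: measurableI.
  by rewrite !EFinM !fin//; exact: measurableI.
have marg1 B : measurable B -> pi0 (B `*` setT) = nu1 B.
  move=> mB; rewrite rect// -(fin nu1)// -part//; congr EFin.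
  (* For fixed [j] the row [t j] has sum [q j], so the weights restore the full mass of B in A_j. *)
  apply: eq_bigr => j _; under eq_bigr do rewrite setTI.
  by apply: transport_weight => //; exact: le.
have marg2 B : measurable B -> pi0 (setT `*` B) = nu2 B.
  move=> mB; rewrite rect// -(fin nu2)// -part//; congr EFin.
  rewrite exchange_big/=; apply: eq_bigr => i _.
  (* The same argument on the column [t^~ i], whose sum is [p i], with the roles of [q] and [p]
     exchanged. *)
  rewrite -[RHS](@transport_weight _ _ (t^~ i) q (p i))//; last exact: le.
  apply: eq_bigr => j _.
  by rewrite setTI (mulrC (q j)) (mulrC (fine (nu1 _))).
have pi0T : pi0 setT = 1%E.
  by rewrite -setXTT marg1// probability_setT.
have [pi piE] := probability_of_measure (nu1 \x nu2)%E pi0T.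
exists pi; first by move=> B mB; rewrite !piE marg1// marg2.
have mS : measurable (\bigcup_i (A i `*` A i)).
  by apply: fin_bigcup_measurable => //; exact: finite_finset.
rewrite probability_setC//.
have tAA : trivIset setT (fun i => A i `*` A i).
  move=> i j _ _ [[x y] [[/= Aix _] [/= Ajx _]]].
  by apply: tA => //; exists x.
have piS : ((\sum_i t i i)%:E <= pi (\bigcup_i (A i `*` A i)))%E.
  rewrite bigcup_bigsetU measure_bigsetU_ord// -sumEFin.
  apply: lee_sum => i _; rewrite [leRHS](piE _) rect// lee_fin.
  rewrite (bigD1 i)//= (bigD1 i)//= !setIid -/(q i) -/(p i).
  (* If the denominator is 0, then [t i i] is 0 as well, being bounded by both [q i] and [p i]. *)
  have -> : t i i / (q i * p i) * (q i * p i) = t i i.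
    have [|/divfK//] := eqVneq (q i * p i) 0.
    move=> qp0; rewrite qp0 mulr0; move/eqP: qp0.
    rewrite mulf_eq0 => /orP[]/eqP z.
      by apply/esym/le_anti; rewrite t0 -z tleq.
    by apply/esym/le_anti; rewrite t0 -z tlep.
  (* Only a lower bound is needed, so the other summands are dropped as nonnegative. *)
  rewrite -addrA lerDl addr_ge0//; apply: sumr_ge0 => l _.
    by rewrite mulr_ge0// mulr_ge0// ge0.
  by apply: sumr_ge0 => l' _; rewrite mulr_ge0// mulr_ge0.
apply: (@le_trans _ _ (1 - \sum_i t i i)%:E); last by rewrite lee_fin.
by rewrite EFinB leeB.
Qed.

(** For the coupling above, the cost is at most [e] when both points share a cell and at most [D]
    otherwise; integrating [e] plus [D] times the indicator of the complement of the diagonal cells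
    gives the bound. *)
Lemma wasserstein2_sq_le_partition (d : measure_display)
  (M : measurableType d) (R : realType) (rho : M -> M -> R)
  (nu1 nu2 : probability M R) (k : nat) (A : 'I_k -> set M) (e D : R) :
  (forall i, measurable (A i)) -> trivIset setT A ->
  (forall x, exists i, A i x) ->
  (forall i x y, A i x -> A i y -> rho x y ^+ 2 <= e) ->
  (forall x y, rho x y ^+ 2 <= D) -> 0 <= e -> 0 <= D ->
  (wasserstein2_sq rho nu1 nu2 <=
   (e + D * \sum_i `|fine (nu1 (A i)) - fine (nu2 (A i))|)%:E)%E.
Proof.
move=> mA tA cA Ae MD e0 D0.
have [pi cpi piS] := partition_coupling nu1 nu2 mA tA cA.
set S := \bigcup_i (A i `*` A i) in piS.
have mS : measurable (~` S).
  apply/measurableC/fin_bigcup_measurable; first exact: finite_finset.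
  by move=> i _; exact: measurableX.
apply: (@le_trans _ _ (\int[pi]_z ((rho z.1 z.2) ^+ 2)%:E)%E).
  by apply: ereal_inf_lbound; exists pi.
apply: (@le_trans _ _ (\int[pi]_z (e%:E + D%:E * (\1_(~` S) z)%:E))%E).
  apply: le_lower_integral => -[x y] /=; first by rewrite lee_fin sqr_ge0.
  rewrite -EFinM -EFinD lee_fin indicE.
  have [/set_mem nS|] := boolP ((x, y) \in ~` S).
    by rewrite mulr1 (le_trans (MD x y))// lerDr.
  rewrite notin_setE => /contrapT[i _ [/= Aix Aiy]].
  by rewrite mulr0 addr0; exact: Ae Aix Aiy.
rewrite ge0_integralD//=; last 2 first.
- by move=> z _; rewrite mule_ge0// lee_fin.
- by apply/measurable_funeM/measurable_EFinP; exact: measurable_indic.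
rewrite integral_cst//= probability_setT mule1 ge0_integralZl//; last first.
  exact/measurable_EFinP/measurable_indic.
rewrite integral_indic// setIT EFinD leeD2l// EFinM.
by rewrite lee_wpmul2l// lee_fin.
Qed.

(** * Compactness: total boundedness, bounded diameter, small Borel cells *)

Lemma rho_open_ball (R : realType) (M : Type) (rho : M -> M -> R) (x : M)
  (r : R) : is_metric rho -> rho_open rho (rho_ball rho x r).
Proof.
case=> _ _ _ tri y /= xy; exists (r - rho x y); first by rewrite subr_gt0.
move=> z /= yz; rewrite /rho_ball/=; apply: le_lt_trans (tri x y z) _.
by rewrite -ltrBrDl.
Qed.

Lemma rho_compact_totally_bounded (R : realType) (M : Type)
  (rho : M -> M -> R) (r : R) : is_metric rho -> rho_compact rho -> 0 < r ->
  exists (n : nat) (c : 'I_n -> M), forall x, exists i, rho (c i) x < r.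
Proof.
move=> rho_metric cM r0; apply: (cM M (fun x => rho_ball rho x r)).
  by move=> x; exact: rho_open_ball.
move=> x; exists x; case: rho_metric => _ rho0 _ _.
by rewrite /rho_ball/= (rho0 x x).2.
Qed.

Lemma rho_compact_bounded (R : realType) (M : Type) (rho : M -> M -> R) :
  is_metric rho -> rho_compact rho ->
  exists2 D : R, 0 <= D & forall x y, rho x y ^+ 2 <= D.
Proof.
move=> rho_metric cM; have := rho_metric => -[rho_ge0 _ rhoC tri].
have [n [c cov]] := rho_compact_totally_bounded rho_metric cM ltr01.
(* Any two points are joined through centres of unit balls: the 2 pays for the end pieces, and the
   sum over all pairs of centres dominates the distance between the two chosen ones. *)
pose D := 2 + \sum_i \sum_j rho (c i) (c j).
exists (D ^+ 2); first exact: sqr_ge0.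
move=> x y; rewrite lerXn2r ?nnegrE//.
  by rewrite addr_ge0// sumr_ge0// => i _; exact: sumr_ge0.
have [i ix] := cov x; have [j jy] := cov y.
have ijD : rho (c i) (c j) <= \sum_i \sum_j rho (c i) (c j).
  rewrite (bigD1 i)//= (bigD1 j)//= -addrA lerDl addr_ge0//.
    exact: sumr_ge0.
  by apply: sumr_ge0 => i' _; exact: sumr_ge0.
have := tri x (c i) y; have := tri (c i) (c j) y.
by rewrite /D (rhoC x (c i)); lra.
Qed.

(** A finite cover by balls is made disjoint by removing from each ball those of smaller index. Some
    cells may be empty, which is harmless. *)
Lemma rho_compact_partition (R : realType) (d : measure_display)
  (M : measurableType d) (rho : M -> M -> R) (e : R) :
  is_metric rho -> rho_compact rho ->
  (measurable : set (set M)) = rho_borel rho -> 0 < e ->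
  exists (n : nat) (A : 'I_n -> set M), [/\ forall i, measurable (A i),
    trivIset setT A, forall x, exists i, A i x &
    forall i x y, A i x -> A i y -> rho x y ^+ 2 <= e].
Proof.
move=> rho_metric cM borel e0; have := rho_metric => -[rho_ge0 _ rhoC tri].
(* Two points of a ball of radius [r] are less than [2 * r], the square root of [e], apart. *)
pose r := Num.sqrt e / 2.
have r0 : 0 < r by rewrite divr_gt0// sqrtr_gt0.
have [n [c cov]] := rho_compact_totally_bounded rho_metric cM r0.
pose A (i : 'I_n) := rho_ball rho (c i) r `\`
  \bigcup_(j in [set j : 'I_n | (j < i)%N]) rho_ball rho (c j) r.
have mball x : measurable (rho_ball rho x r).
  by rewrite borel; apply: sub_sigma_algebra; exact: rho_open_ball.
exists n, A; split.
- move=> i; apply: measurableD => //; apply: fin_bigcup_measurable => //.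
- move=> i j _ _ [x [[xi ni] [xj nj]]]; apply/val_inj.
  have [ij|ji|//] := ltngtP i j; exfalso.
    by apply: nj; exists i.
  by apply: ni; exists j.
- move=> x; have [i0 i0x] := cov x.
  (* The cell of x is the one of least index among the balls containing x. *)
  pose Q := fun k : nat =>
    `[< exists2 i : 'I_n, i = k :> nat & rho (c i) x < r >].
  have exQ : exists k, Q k by exists i0; apply/asboolP; exists i0.
  case: (ex_minnP exQ) => k /asboolP[i <- ix] min; exists i; split=> //.
  move=> [j /= ji jx]; have : (i <= j)%N by apply: min; apply/asboolP; exists j.
  by rewrite leqNgt ji.
- move=> i x y [/= ix _] [iy _].
  rewrite /rho_ball/= in ix iy.
  rewrite -[leRHS](sqr_sqrtr (ltW e0)) lerXn2r ?nnegrE// ?sqrtr_ge0//.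
  have := tri x (c i) y; rewrite (rhoC x (c i)).
  by move: ix iy; rewrite /r; lra.
Qed.

(** * The empirical measure as a probability *)

Lemma empirical_measure_probability (R : realType)
  (dO : measure_display) (Omega : measurableType dO) (d : measure_display)
  (M : measurableType d) (mu : probability M R) (X : nat -> Omega -> M)
  (N : nat) (w : Omega) : (0 < N)%N ->
  exists Q : probability M R,
    forall A, Q A = empirical_measure (R := R) X N w A.
Proof.
move=> N0; have Ni : 0 <= (N%:R : R)^-1 by rewrite invr_ge0.
have [m mE] := @measure_seq_sum _ M R 'I_N (index_enum 'I_N)
  (fun n : 'I_N => \d_(X n w)).
have mNE A : mscale (NngNum Ni) m A = empirical_measure (R := R) X N w A.
  by rewrite /mscale/= mE.
have mT : mscale (NngNum Ni) m setT = 1%E.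
  rewrite mNE /empirical_measure; under eq_bigr do rewrite indicT.
  rewrite sumEFin sumr_const card_ord -EFinM mulVf//.
  by rewrite pnatr_eq0 -lt0n.
have [Q QE] := probability_of_measure mu mT.
by exists Q => A; rewrite QE; exact: mNE.
Qed.

(** * Second moment of the deviation of an empirical frequency *)

(** Passing from N to N+1 adds a row, a column equal to it by symmetry, and one diagonal term. The
    off-diagonal part takes the form of the sum over pairs m < n in the mixing hypothesis. *)
Lemma sum_sym_square (R : realDomainType) (c : nat -> nat -> R) (N : nat) :
  (forall n m, c n m = c m n) ->
  \sum_(n < N) \sum_(m < N) c n m =
  \sum_(n < N) c n n + 2 * \sum_(n < N) \sum_(m < n) c m n.
Proof.
move=> cC; elim: N => [|N IH]; first by rewrite !big_ord0 mulr0 addr0.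
rewrite big_ord_recr/=; under eq_bigr do rewrite big_ord_recr/=.
rewrite big_split/= IH !big_ord_recr/=.
rewrite (eq_bigr (fun m : 'I_N => c m N) (fun m _ => cC N m)); ring.
Qed.

Lemma integrable_sum_EFin (d : measure_display) (T : measurableType d)
  (R : realType) (P : {measure set T -> \bar R}) (I : Type) (s : seq I)
  (f : I -> T -> R) : (forall i, P.-integrable setT (EFin \o f i)) ->
  P.-integrable setT (EFin \o (fun w => \sum_(i <- s) f i w)).
Proof.
move=> intf.
have -> : EFin \o (fun w => \sum_(i <- s) f i w) =
    (fun w => \sum_(i <- s) (EFin \o f i) w)%E.
  by apply/funext => w /=; rewrite sumEFin.
exact: integrable_sum.
Qed.

Lemma Rintegral_sum (d : measure_display) (T : measurableType d)
  (R : realType) (P : {measure set T -> \bar R}) (I : Type) (s : seq I)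
  (f : I -> T -> R) : (forall i, P.-integrable setT (EFin \o f i)) ->
  \int[P]_w (\sum_(i <- s) f i w) = \sum_(i <- s) \int[P]_w f i w.
Proof.
move=> intf; elim: s => [|i s IH].
  rewrite big_nil; under eq_Rintegral do rewrite big_nil.
  by rewrite /Rintegral integral0.
rewrite big_cons -IH -RintegralD//; last exact: integrable_sum_EFin.
by apply: eq_Rintegral => w _; rewrite big_cons.
Qed.

Section indicators.
Context (R : realType) (d : measure_display) (T : measurableType d)
  (P : probability T R).

Lemma centered_indicM (E F : set T) (p : R) (w : T) :
  (\1_E w - p) * (\1_F w - p) =
  \1_(E `&` F) w + ((- p) * \1_E w + ((- p) * \1_F w + p ^+ 2)).
Proof. by rewrite indicI /=; ring. Qed.

Lemma integrable_centered_indicM (E F : set T) (p : R) :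
  measurable E -> measurable F ->
  P.-integrable setT (EFin \o (fun w => (\1_E w - p) * (\1_F w - p))).
Proof.
move=> mE mF; apply: measurable_bounded_integrable => //.
- exact: (le_lt_trans (probability_le1 P measurableT) (ltry 1)).
- by apply: measurable_funM; apply: measurable_funB => //;
    exact: measurable_indic.
- exists ((1 + `|p|) * (1 + `|p|)); split; first exact: num_real.
  move=> x xp w _ /=; apply: le_trans (ltW xp); rewrite normrM.
  have b G : `|\1_G w - p| <= 1 + `|p|.
    rewrite (le_trans (ler_normB _ _))// lerD2r indicE.
    by case: (_ \in _); rewrite ?normr1 ?normr0.
  by rewrite ler_pM.
Qed.

(** This is the covariance of two indicators of mean [p]: the two linear terms contribute [- p ^+ 2]
    each and the constant gives one [p ^+ 2] back. *)
Lemma Rintegral_centered_indicM (E F : set T) (p : R) :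
  measurable E -> measurable F -> fine (P E) = p -> fine (P F) = p ->
  \int[P]_w ((\1_E w - p) * (\1_F w - p)) = fine (P (E `&` F)) - p ^+ 2.
Proof.
move=> mE mF PE PF; under eq_Rintegral do rewrite centered_indicM.
have int1 (G : set T) : measurable G ->
    P.-integrable setT (EFin \o (\1_G : T -> R)) by exact: integrable_indic.
have intZ (G : set T) : measurable G ->
    P.-integrable setT (EFin \o (fun w => (- p) * \1_G w)).
  by move=> mG; exact: (integrableZl measurableT (- p) (int1 G mG)).
have intc : P.-integrable setT (EFin \o (fun w : T => p ^+ 2)).
  exact: finite_measure_integrable_cst.
have int2 : P.-integrable setT (EFin \o (fun w => (- p) * \1_F w + p ^+ 2)).
  exact: (integrableD measurableT (intZ _ mF) intc).
have int3 : P.-integrable setT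
    (EFin \o (fun w => (- p) * \1_E w + ((- p) * \1_F w + p ^+ 2))).
  exact: (integrableD measurableT (intZ _ mE) int2).
have Rint1 (G : set T) : measurable G -> \int[P]_w (\1_G w) = fine (P G).
  by move=> mG; rewrite /Rintegral integral_indic// setIT.
rewrite RintegralD//; last exact/int1/measurableI.
rewrite RintegralD//; last exact: intZ.
rewrite RintegralD//; last exact: intZ.
rewrite RintegralZl//; last exact: int1.
rewrite RintegralZl//; last exact: int1.
rewrite !Rint1//; last exact: measurableI.
rewrite Rintegral_cst//= probability_setT/= PE PF; ring.
Qed.

Lemma frequencyB_sqrE (E : nat -> set T) (p : R) (N : nat) (w : T) :
  (0 < N)%N ->
  (N%:R^-1 * \sum_(n < N) \1_(E n) w - p) ^+ 2 =
  N%:R ^- 2 * \sum_(n < N) \sum_(m < N) ((\1_(E n) w - p) * (\1_(E m) w - p)).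
Proof.
move=> N0; have N0' : N%:R != 0 :> R by rewrite pnatr_eq0 -lt0n.
have -> : N%:R^-1 * \sum_(n < N) \1_(E n) w - p =
    N%:R^-1 * \sum_(n < N) (\1_(E n) w - p).
  by rewrite sumrB sumr_const card_ord -mulr_natr; field.
by rewrite exprMn exprVn; congr (_ * _); rewrite expr2 big_distrlr.
Qed.

Lemma integrable_frequencyB_sqr (E : nat -> set T) (p : R) (N : nat) :
  (0 < N)%N -> (forall n, measurable (E n)) ->
  P.-integrable setT
    (EFin \o (fun w => (N%:R^-1 * \sum_(n < N) \1_(E n) w - p) ^+ 2)).
Proof.
move=> N0 mE; under [EFin \o _]eq_fun do rewrite /= frequencyB_sqrE//.
have int2 : P.-integrable setT (EFin \o (fun w =>
    \sum_(n < N) \sum_(m < N) ((\1_(E n) w - p) * (\1_(E m) w - p)))).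
  apply: integrable_sum_EFin => n; apply: integrable_sum_EFin => m.
  exact: integrable_centered_indicM.
exact: (integrableZl measurableT (N%:R ^- 2) int2).
Qed.

(** The squared deviation expands into a double sum of covariances. The diagonal ones are variances,
    at most 1 each, whence the term N; each pair m < n occurs twice and is bounded by [a m n]. *)
Lemma Rintegral_frequencyB_sqr (E : nat -> set T) (p : R)
  (a : nat -> nat -> R) (N : nat) : (0 < N)%N ->
  (forall n, measurable (E n)) -> (forall n, fine (P (E n)) = p) ->
  (forall m n, `|fine (P (E m `&` E n)) - p * p| <= a m n) ->
  \int[P]_w ((N%:R^-1 * \sum_(n < N) \1_(E n) w - p) ^+ 2) <=
  N%:R ^- 2 * (N%:R + 2 * \sum_(n < N) \sum_(m < n) a m n).
Proof.
move=> N0 mE PE PEE; under eq_Rintegral do rewrite frequencyB_sqrE//.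
have intM n m := integrable_centered_indicM p (mE n) (mE m).
rewrite RintegralZl//; last first.
  by do 2!apply: integrable_sum_EFin => ?.
rewrite Rintegral_sum; last by move=> n; exact: integrable_sum_EFin.
under eq_bigr => n _.
  rewrite Rintegral_sum//.
  under eq_bigr do rewrite Rintegral_centered_indicM//.
  over.
rewrite ler_wpM2l ?invr_ge0 ?exprn_ge0//.
rewrite (sum_sym_square
  (c := fun n m => fine (P (E n `&` E m)) - p ^+ 2)); last first.
  by move=> n m; rewrite setIC.
rewrite lerD// ?ler_wpM2l//; last first.
  apply: ler_sum => n _; apply: ler_sum => m _.
  by rewrite expr2 (le_trans (ler_norm _)).
rewrite -[leRHS]mulr1 mulr_natl -[X in _ *+ X]card_ord -sumr_const.
apply: ler_sum => n _; rewrite setIid PE lerBlDr (@le_trans _ _ 1)//.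
  by rewrite -(PE n) -lee_fin fineK ?fin_num_measure// probability_le1.
by rewrite lerDl sqr_ge0.
Qed.
End indicators.

(** * Mixing coefficients and the bound on the expected squared distance *)

Lemma alpha_mixing_ge (R : realType) (dO : measure_display)
  (Omega : measurableType dO) (d : measure_display) (M : measurableType d)
  (P : probability Omega R) (X Y : Omega -> M) (A B : set M) :
  measurable_fun setT X -> measurable_fun setT Y ->
  measurable A -> measurable B ->
  `|fine (P (X @^-1` A `&` Y @^-1` B))
    - fine (P (X @^-1` A)) * fine (P (Y @^-1` B))| <= alpha_mixing P X Y.
Proof.
move=> mX mY mA mB; apply: ub_le_sup; last by exists A, B.
have P01 E : measurable E -> 0 <= fine (P E) <= 1.
  move=> mE; rewrite fine_ge0//= -lee_fin fineK ?fin_num_measure//.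
  exact: probability_le1.
(* The real-valued [sup] is an upper bound only once the set is known to be bounded; here 1 bounds
   it, as all three probabilities lie in [0, 1]. *)
exists 1 => _ [A' [B' [mA' mB' ->]]].
have mXA : measurable (X @^-1` A') by rewrite -[_ @^-1` _]setTI; exact: mX.
have mYB : measurable (Y @^-1` B') by rewrite -[_ @^-1` _]setTI; exact: mY.
have /andP[a0 a1] := P01 _ mXA; have /andP[b0 b1] := P01 _ mYB.
have /andP[c0 c1] := P01 _ (measurableI _ _ mXA mYB).
have ab0 := mulr_ge0 a0 b0; have ab1 := mulr_ile1 a0 b0 a1 b1.
by rewrite ler_norml; lra.
Qed.

(** The partition bound involves absolute deviations, while mixing controls squares. Trading |x| for
    delta + x^2 / delta makes the second moment suffice; the factor [k] counts the cells, whose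
    moment bounds coincide. *)
Lemma expectation_wasserstein2_sq_le (R : realType)
  (d : measure_display) (M : measurableType d) (rho : M -> M -> R)
  (dO : measure_display) (Omega : measurableType dO) (P : probability Omega R)
  (X : nat -> Omega -> M) (mu : probability M R) (k : nat) (A : 'I_k -> set M)
  (e D delta : R) (N : nat) :
  (forall n, measurable_fun setT (X n)) ->
  (forall n (B : set M), measurable B -> P (X n @^-1` B) = mu B) ->
  (forall i, measurable (A i)) -> trivIset setT A ->
  (forall x, exists i, A i x) ->
  (forall i x y, A i x -> A i y -> rho x y ^+ 2 <= e) ->
  (forall x y, rho x y ^+ 2 <= D) -> 0 <= e -> 0 <= D -> 0 < delta ->
  (0 < N)%N ->
  (\int[P]_w wasserstein2_sq rho (empirical_measure X N w) mu <=
   (e + D * (k%:R * (delta + delta^-1 * (N%:R ^- 2 * (N%:R + 2 *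
     \sum_(n < N) \sum_(m < n) alpha_mixing P (X m) (X n))))))%:E)%E.
Proof.
move=> mX XE mA tA cA Ae MD e0 D0 delta0 N0.
pose E i n := X n @^-1` A i; pose p i := fine (mu (A i)).
have mE i n : measurable (E i n) by rewrite /E -[_ @^-1` _]setTI; exact: mX.
have PE i n : fine (P (E i n)) = p i by rewrite /E XE.
pose f i w := (N%:R^-1 * \sum_(n < N) \1_(E i n) w - p i) ^+ 2.
have intf i : P.-integrable setT (EFin \o f i).
  exact: integrable_frequencyB_sqr.
pose g w := \sum_(i < k) delta^-1 * f i w.
have intZf i : P.-integrable setT (EFin \o (fun w => delta^-1 * f i w)).
  exact: (integrableZl measurableT delta^-1 (intf i)).
have intg : P.-integrable setT (EFin \o g) by exact: integrable_sum_EFin.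
have intDg : P.-integrable setT (EFin \o (fun w => D * g w)).
  exact: (integrableZl measurableT D intg).
pose C := e + D * (k%:R * delta).
have intC : P.-integrable setT (EFin \o (fun w : Omega => C)).
  exact: finite_measure_integrable_cst.
have intG : P.-integrable setT (EFin \o (fun w => C + D * g w)).
  exact: (integrableD measurableT intC intDg).
(* An integrable majorant is reached first; from there on linearity of the integral is available. *)
apply: (@le_trans _ _ (\int[P]_w (C + D * g w)%:E)%E).
  apply: le_lower_integral => w.
    apply: le_ereal_inf_tmp => _ [pi _ <-]; apply: integral_ge0 => z _.
    by rewrite lee_fin sqr_ge0.
  have [Q QE] := empirical_measure_probability mu X w N0.
  have -> : empirical_measure X N w = Q by apply/funext => B; rewrite QE.
  apply: le_trans (wasserstein2_sq_le_partition Q mu mA tA cA Ae MD e0 D0) _.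
  rewrite lee_fin /C -addrA lerD2l -mulrDr ler_wpM2l//.
  rewrite mulr_natl -[X in _ *+ X]card_ord -sumr_const -big_split/=.
  apply: ler_sum => i _.
  have -> : fine (Q (A i)) = N%:R^-1 * \sum_(n < N) \1_(E i n) w.
    by rewrite QE /empirical_measure sumEFin.
  rewrite /f -/(p i); set x := _ - p i.
  (* AM-GM: |x| <= delta + x^2 / delta *)
  rewrite -(@ler_pM2l _ delta)// mulrDr mulrA divff ?gt_eqF// mul1r.
  rewrite -[x ^+ 2]real_normK ?num_real//.
  have := normr_ge0 x; have := sqr_ge0 (delta - `|x|); nra.
rewrite -[leLHS]fineK; last exact: integrable_fin_num.
rewrite lee_fin -/(Rintegral P setT (fun w => C + D * g w)).
rewrite RintegralD// RintegralZl// Rintegral_cst// Rintegral_sum//.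
rewrite [X in C * X](_ : _ = 1) ?mulr1; last by rewrite /= probability_setT.
rewrite /C -addrA lerD2l -mulrDr ler_wpM2l// [leRHS]mulrDr lerD2l.
rewrite mulr_natl -[X in _ *+ X]card_ord -sumr_const; apply: ler_sum => i _.
rewrite RintegralZl// ler_wpM2l ?invr_ge0 ?(ltW delta0)//.
apply: (@Rintegral_frequencyB_sqr _ _ _ P (E i) (p i)
  (fun m n => alpha_mixing P (X m) (X n))) => // m n.
by rewrite -{1}(PE i m) -(PE i n); exact: alpha_mixing_ge.
Qed.

(** * Choice of the parameters and convergence *)

Theorem theorem1 (R : realType)
  (d : measure_display) (M : measurableType d) (rho : M -> M -> R)
  (rho_metric : is_metric rho)
  (M_compact : rho_compact rho)
  (M_connected : rho_connected rho)
  (M_borel : (measurable : set (set M)) = rho_borel rho)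
  (dO : measure_display) (Omega : measurableType dO) (P : probability Omega R)
  (X : nat -> Omega -> M) (mu : probability M R)
  (X_meas : forall n, measurable_fun setT (X n))
  (X_law : forall n (A : set M), measurable A -> P (X n @^-1` A) = mu A)
  (mixing : (fun N : nat => (N%:R ^- 2) *
        \sum_(n < N) \sum_(m < n) alpha_mixing P (X m) (X n)) @ \oo --> 0%R) :
  (fun N : nat =>
     (\int[P]_w wasserstein2_sq rho (empirical_measure X N w) mu)%E)
    @ \oo --> 0%E.
Proof.
pose u N := (\int[P]_w wasserstein2_sq rho (empirical_measure X N w) mu)%E.
have u0 N : (0 <= u N)%E.
  apply: integral_ge0 => w _; apply: le_ereal_inf_tmp => _ [pi _ <-].
  by apply: integral_ge0 => z _; rewrite lee_fin sqr_ge0.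
have [D D0 MD] := rho_compact_bounded rho_metric M_compact.
have small (eta : R) : 0 < eta -> \forall N \near \oo, (u N <= eta%:E)%E.
  move=> eta0; have e0 : 0 < eta / 2 by rewrite divr_gt0.
  have [k [A [mA tA cA Ae]]] :=
    rho_compact_partition rho_metric M_compact M_borel e0.
  (* Adding 1 keeps [K] positive even if [D * k%:R] is 0. With [delta] as below,
     [K * (delta + delta)] is [eta / 2], the other half of [eta] being the cell bound. *)
  pose K := D * k%:R + 1.
  have K0 : 0 < K by rewrite ltr_wpDl// mulr_ge0.
  pose delta := eta / (4 * K).
  have delta0 : 0 < delta by rewrite divr_gt0// mulr_gt0.
  (* Once 1/N and the normalized mixing sum are both at most [c], the second moment bound, 1/N plus
     twice that sum, is at most [3 * c], that is [delta * delta]. *)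
  pose c := delta * delta / 3.
  have c0 : 0 < c by rewrite divr_gt0// mulr_gt0.
  have Sle := cvgr_le _ mixing _ c0.
  near=> N.
  (* This one bound on N yields both N > 0 and 1/N at most [c]. *)
  have cN : c^-1 + 1 <= N%:R by near: N; exact: nbhs_infty_ger.
  have N0 : (0 < N)%N.
    rewrite -(ltr_nat R); apply: lt_le_trans cN.
    by rewrite addr_gt0// invr_gt0.
  have NR0 : 0 < N%:R :> R by rewrite ltr0n.
  have SN : N%:R ^- 2 *
      \sum_(n < N) \sum_(m < n) alpha_mixing P (X m) (X n) <= c.
    by near: N; exact: Sle.
  apply: le_trans (expectation_wasserstein2_sq_le X_meas X_law mA tA cA Ae MD
    (ltW e0) D0 delta0 N0) _.
  rewrite lee_fin.
  have NV : N%:R^-1 <= c.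
    rewrite -[leRHS]invrK lef_pV2 ?posrE ?invr_gt0//.
    by rewrite (le_trans _ cN)// lerDl.
  have bN : N%:R ^- 2 * (N%:R + 2 *
      \sum_(n < N) \sum_(m < n) alpha_mixing P (X m) (X n)) <= delta * delta.
    rewrite mulrDr mulrCA.
    have -> : N%:R ^- 2 * N%:R = N%:R^-1 :> R by field; rewrite gt_eqF.
    by move: SN NV; rewrite /c; lra.
  have bN' : delta^-1 * (N%:R ^- 2 * (N%:R + 2 *
      \sum_(n < N) \sum_(m < n) alpha_mixing P (X m) (X n))) <= delta.
    by rewrite mulrC ler_pdivrMr.
  apply: (@le_trans _ _ (eta / 2 + K * (delta + delta))).
    rewrite lerD2l mulrA (@le_trans _ _ (D * k%:R * (delta + delta)))//.
      by rewrite ler_wpM2l ?mulr_ge0// lerD2l.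
    by rewrite ler_wpM2r ?lerDl// addr_ge0// ltW.
  rewrite (_ : eta / 2 + _ = eta)// /delta.
  by field; rewrite gt_eqF.
(* Convergence in the extended reals splits into eventual finiteness, from [small] with 1, and
   convergence of the real values. *)
apply/fine_cvgP; split.
  near=> N; rewrite ge0_fin_numE ?u0//.
  rewrite (@le_lt_trans _ _ 1%:E) ?ltry//; near: N.
  exact: small.
apply/cvgrPdist_le => eta eta0; near=> N.
have uN : (u N <= eta%:E)%E by near: N; exact: small.
rewrite sub0r normrN ger0_norm/= ?fine_ge0 ?u0//.
rewrite -lee_fin fineK// ge0_fin_numE ?u0//.
exact: le_lt_trans uN (ltry _).
Unshelve. all: by end_near. Qed.
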